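(* Let $n\ge 2$, $\rho\in(0,1/2]$, $1\le m\le n-1$ and $s\in(0,1]$. Then $$\mathcal{E}_{m,1}\le 3en\,(1/\rho)^{\lfloor n/2\rfloor}\qquad\text{and}\qquad \mathcal{E}_{m,s}\le (c/s)^m(1/\rho)^{n-1},$$ where $c=Cmn$ for an absolute constant $C>0$.
   Context: Fix $n\ge 2$ and a weight threshold $\rho\in(0,1/2]$. An averaging system consists of: - a sequence $(G_t)_{t\ge0}$ of undirected graphs on the vertex set $[n]$, each containing a self-loop at every vertex; - $n\times n$ row-stochastic matrices $P_t$ such that $(P_t)_{ij}>0$ if and only if $\{i,j\}$ is an edge of $G_t$ (so the diagonal is positive), and every nonzero entry of $P_t$ is at least $\rho$. Given $x(0)\in\mathbb{R}^n$, set $x(t+1)=P_tx(t)$ for $t\ge 0$. At time $t$, every edge $\{i,j\}$ of $G_t$ with $i\ne j$ is embedded as the closed interval with endpoints $x_i(t)$ and $x_j(t)$. The union of these intervals is a disjoint union of closed intervals, called blocks, with lengths $l_1(t),\dots,l_{k_t}(t)$. For $s\in(0,1]$ put $E_{s,t}=\sum_{i=1}^{k_t}l_i(t)^s$ and define the $s$-energy as $E_s=\sum_{t\ge0}E_{s,t}$. Let $\mathcal{E}_{m,s}$ denote the supremum of $E_s$ over all averaging systems (with the given $n$ and $\rho$) in which every $G_t$ has at most $m$ connected components, and over all initial positions $x(0)\in[0,1]^n$. *)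

(* Defs.v *)
From HB Require Import structures.
From mathcomp Require Import all_boot all_order all_algebra.
From mathcomp Require Import all_classical all_reals all_analysis.
From mathcomp Require Import Rstruct Rstruct_topology.
Set Implicit Arguments. Unset Strict Implicit. Unset Printing Implicit Defensive.
Import Order.TTheory GRing.Theory Num.Theory.
Import numFieldNormedType.Exports.
Local Open Scope classical_set_scope.
Local Open Scope ring_scope.

Section Averaging.
Variable R : realType.
Variable n : nat.

Definition averaging_system (rho : R) (G : nat -> rel 'I_n)
    (P : nat -> 'M[R]_n) : Prop :=
  forall t : nat,
    [/\ (forall i j, G t i j = G t j i) /\ (forall i, G t i i),
        (forall i j, 0 <= P t i j),
        (forall i, \sum_(j < n) P t i j = 1),
        (forall i j, 0 < P t i j <-> G t i j) &
        (forall i j, P t i j != 0 -> rho <= P t i j)].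

Definition num_components (g : rel 'I_n) : nat := n_comp (connect g) 'I_n.

Fixpoint traj (P : nat -> 'M[R]_n) (x0 : 'I_n -> R) (t : nat) : 'I_n -> R :=
  match t with
  | 0 => x0
  | t'.+1 => fun i => \sum_(j < n) P t' i j * traj P x0 t' j
  end.

Definition edge_union (g : rel 'I_n) (x : 'I_n -> R) : set R :=
  [set y | exists i j : 'I_n, [/\ i != j, g i j &
        Num.min (x i) (x j) <= y <= Num.max (x i) (x j)]].

Definition blocks (g : rel 'I_n) (x : 'I_n -> R) : set (set R) :=
  [set connected_component (edge_union g x) y | y in edge_union g x].

Definition block_length (B : set R) : R := sup B - inf B.

Definition energy_step (s : R) (g : rel 'I_n) (x : 'I_n -> R) : R :=
  \sum_(B \in blocks g x) (block_length B) `^ s.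

Definition s_energy (s : R) (G : nat -> rel 'I_n) (P : nat -> 'M[R]_n)
    (x0 : 'I_n -> R) : \bar R :=
  (\sum_(0 <= t <oo) (energy_step s (G t) (traj P x0 t))%:E)%E.

Definition sup_energy (rho : R) (m : nat) (s : R) : \bar R :=
  ereal_sup [set e | exists (G : nat -> rel 'I_n) (P : nat -> 'M[R]_n)
      (x0 : 'I_n -> R),
      [/\ averaging_system rho G P,
          (forall t, (num_components (G t) <= m)%N),
          (forall i, 0 <= x0 i <= 1) &
          e = s_energy s G P x0]].

End Averaging.

(* Main.v *)
(** Sort the agents at each time and call a gap between consecutive agents cut
    if it has positive length and no edge crosses it. Between two cuts, an agent
    of rank j moves to at least p + rho (x_(j+1) - p), where p is the left end of
    its block, and symmetrically on the right. Hence, to the right of a cut at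
    index a, the weighted sum of rho^i x_(a+i) over i < k never decreases, and it
    gains at each step at least rho^k times the length covered by blocks between
    ranks a and a + k. Using this potential on the left half and its mirror image
    on the right half bounds the 1-energy.

    For s < 1, follow the system while its diameter stays in [D/2, D]. Either
    blocks cover a constant fraction of the diameter, which happens
    O(rho^(1-n)) times, or some cut gap has length at least D/(4m). As long as
    that gap, between ranks i and i + 1, remains cut, it splits the system into
    two systems with fewer components, to which induction applies. A cut gap
    never shrinks, so the split ends only when an edge covers a wide gap; the two
    potentials show that this happens O(m rho^(-min(i, n-i))) times, which exactly
    compensates the loss of agents in the induction. Summing the geometric series
    over the scales D = 2^(-k) contributes the factor 1/s. *)
Require Import Defs.
From HB Require Import structures.
From mathcomp Require Import all_boot all_order all_algebra.
From mathcomp Require Import all_classical all_reals all_analysis.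
From mathcomp Require Import Rstruct Rstruct_topology.
From mathcomp Require Import zify ring lra.
Import Order.TTheory GRing.Theory Num.Theory.
Import numFieldNormedType.Exports.
Local Open Scope ring_scope.
Set Implicit Arguments.
Unset Strict Implicit.
Unset Printing Implicit Defensive.

(** * Twist dynamics *)

(* One move [x -> y] of sorted positions. [c j] says that the gap between ranks
   [j - 1] and [j] is cut, so that the blocks are the maximal runs of ranks without
   inner cut; [p j] and [q j] are the end positions of the block of rank [j]. *)
Record twist_step (R : realType) (rho : R) (n : nat)
    (c : nat -> bool) (p q x y : nat -> R) : Prop := TwistStep {
  tw_cut0 : c 0;
  tw_cutn : c n;
  tw_sorted : forall j, (j.+1 < n)%N -> x j <= x j.+1;
  tw_p_le : forall j, (j < n)%N -> p j <= x j;
  tw_le_q : forall j, (j < n)%N -> x j <= q j;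
  tw_p_cut : forall j, (j < n)%N -> c j -> p j = x j;
  tw_q_cut : forall j, (j < n)%N -> c j.+1 -> q j = x j;
  tw_p_uncut : forall j, (j.+1 < n)%N -> ~~ c j.+1 -> p j.+1 = p j;
  tw_q_uncut : forall j, (j.+1 < n)%N -> ~~ c j.+1 -> q j.+1 = q j;
  tw_lower : forall j, (j < n)%N ->
    p j + rho * (x (if c j.+1 then j else j.+1) - p j) <= y j;
  tw_upper : forall j, (j < n)%N ->
    y j <= q j - rho * (q j - x (if c j then j else j.-1)) }.

Definition gap_cover (R : realType) (c : nat -> bool) (x : nat -> R) (j : nat) : R :=
  if c j then 0 else x j - x j.-1.

(** The length that blocks cover between ranks [a] and [a + d]; the gaps involved are those numbered
    [a + 1] to [a + d]. *)
Definition cover (R : realType) (c : nat -> bool) (x : nat -> R) (a d : nat) : R :=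
  \sum_(i < d) gap_cover c x (a + i).+1.

(* Each block is counted at its leftmost rank. *)
Definition block_energy (R : realType) (s : R) (c : nat -> bool) (q x : nat -> R)
    (a b : nat) : R :=
  \sum_(a <= j < b | c j) (q j - x j) `^ s.

(** * Geometry and potentials of a single step *)

Section Step.
Variables (R : realType) (rho : R) (n : nat).
Variables (c : nat -> bool) (p q x y : nat -> R).
Hypothesis tw : twist_step rho n c p q x y.

Lemma twist_le (i j : nat) : (i <= j)%N -> (j < n)%N -> x i <= x j.
Proof.
elim: j => [|j IH]; first by rewrite leqn0 => /eqP ->.
rewrite leq_eqVlt => /orP[/eqP -> //|ij] jn.
have xj : x i <= x j by apply: IH => //; apply: ltnW.
exact: le_trans xj (tw_sorted tw jn).
Qed.

Lemma gap_cover_ge0 (j : nat) : (j.+1 < n)%N -> 0 <= gap_cover c x j.+1.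
Proof.
by move=> jn; rewrite /gap_cover; case: ifP => //= _; rewrite subr_ge0 (tw_sorted tw).
Qed.

Lemma cover_ge0 (a d : nat) : (a + d < n)%N -> 0 <= cover c x a d.
Proof.
move=> adn; apply: sumr_ge0 => i _; apply: gap_cover_ge0.
by have := ltn_ord i; lia.
Qed.

Lemma cover_recr (a d : nat) :
  cover c x a d.+1 = cover c x a d + gap_cover c x (a + d).+1.
Proof. by rewrite /cover big_ord_recr. Qed.

Lemma cover_recl (a d : nat) :
  cover c x a d.+1 = gap_cover c x a.+1 + cover c x a.+1 d.
Proof.
rewrite /cover big_ord_recl /= addn0; congr (_ + _).
by apply: eq_bigr => i _ /=; rewrite /bump /= add1n addnS addSn.
Qed.

Lemma cover_cat (a d e : nat) :
  cover c x a (d + e) = cover c x a d + cover c x (a + d) e.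
Proof.
elim: e => [|e IH]; first by rewrite addn0 [cover _ _ (a + d) 0]/cover big_ord0 addr0.
by rewrite addnS !cover_recr IH addrA addnA.
Qed.

(** A block is the union of its uncut gaps, so for exponent 1 the block lengths add up to the
    cover. *)
Lemma block_energy1 (a d : nat) : (a + d < n)%N -> c a -> c (a + d).+1 ->
  block_energy 1 c q x a (a + d).+1 = cover c x a d.
Proof.
move=> adn ca ce.
(* A prefix may stop inside a block that is already counted in full; the last term corrects for the
   part of it beyond rank [a + k]. *)
suff -> : forall k, (a + k < n)%N -> block_energy 1 c q x a (a + k).+1 =
    cover c x a k + (q (a + k) - x (a + k)).
- by rewrite (tw_q_cut tw adn ce) subrr addr0.
- by [].
elim=> [|k IH] kn.
  rewrite addn0 in kn *; rewrite /block_energy big_mkcond big_nat1 ca /cover big_ord0 add0r.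
  by rewrite powRr1 // subr_ge0 (tw_le_q tw).
rewrite /block_energy big_mkcond big_nat_recr /=; last by lia.
rewrite -big_mkcond -/(block_energy _ _ _ _ _ _) addnS IH; last by lia.
have kn' : ((a + k).+1 < n)%N by rewrite -addnS.
rewrite cover_recr /gap_cover; case: ifP => cd /=.
  rewrite powRr1 ?subr_ge0 ?(tw_le_q tw) //.
  by rewrite (tw_q_cut tw (ltnW kn') cd) subrr !addr0.
by rewrite (tw_q_uncut tw kn') ?cd //; ring.
Qed.

(** Uncut gaps belong to the cover, and every cut gap is paid for by its own cut. *)
Lemma diameter_cover (a d : nat) (delta : R) (m : nat) : 0 <= delta ->
  (forall i, (i < d)%N -> c (a + i).+1 -> x (a + i).+1 - x (a + i) <= delta) ->
  (\sum_(a <= j < (a + d).+1) c j <= m)%N ->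
  x (a + d) - x a <= cover c x a d + m%:R * delta.
Proof.
move=> del0 small cm.
suff H k : (k <= d)%N ->
    x (a + k) - x a <= cover c x a k + (\sum_(a <= j < (a + k).+1) c j)%:R * delta.
  by apply: le_trans (H d (leqnn _)) _; rewrite lerD2l ler_wpM2r // ler_nat.
elim: k => [|k IH] kd.
  by rewrite addn0 subrr /cover big_ord0 add0r mulr_ge0.
rewrite cover_recr big_nat_recr /=; last by lia.
have := IH (ltnW kd); rewrite natrD addnS /gap_cover /= mulrDl.
case: ifP => cd /=; last by rewrite mul0r; lra.
have := small _ kd cd; rewrite mul1r; lra.
Qed.

Lemma q_le_right_end (a d : nat) : (a + d < n)%N -> c (a + d).+1 -> q a <= x (a + d).
Proof.
elim: d a => [|d IH] a adn ce.
  by rewrite addn0 in adn ce *; rewrite (tw_q_cut tw adn ce).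
have an : (a.+1 < n)%N by lia.
case cd : (c a.+1).
  by rewrite (tw_q_cut tw (ltnW an) cd); apply: twist_le => //; lia.
by rewrite -(tw_q_uncut tw an) ?cd // -addSnnS IH // addSnnS.
Qed.

(** There are at most [m] blocks, and the cut at [(a + d).+1] keeps each of them within the span of
    the range. *)
Lemma block_energy_le (s : R) (m a d : nat) : 0 <= s -> (a + d < n)%N ->
  c (a + d).+1 -> (\sum_(a <= j < (a + d).+1) c j <= m)%N ->
  block_energy s c q x a (a + d).+1 <= m%:R * (x (a + d) - x a) `^ s.
Proof.
move=> s0 adn ce cm.
apply: (@le_trans _ _ (\sum_(a <= j < (a + d).+1) (c j)%:R * (x (a + d) - x a) `^ s)).
  rewrite /block_energy big_mkcond; apply: ler_sum_nat => j /andP[aj jd].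
  case: ifP => cj; rewrite ?mul0r // mul1r ge0_ler_powR ?nnegrE ?subr_ge0 //.
  - by apply: (tw_le_q tw); lia.
  - by apply: twist_le; lia.
  - rewrite lerB // ?twist_le //; last by lia.
    by rewrite -(subnKC (_ : j <= a + d)%N) //; apply: q_le_right_end; rewrite subnKC.
by rewrite -mulr_suml -natr_sum ler_wpM2r ?powR_ge0 // ler_nat.
Qed.

Hypothesis rho_gt0 : 0 < rho.
Let rho_ge0 : 0 <= rho := ltW rho_gt0.

Lemma twist_left_end_ge (a : nat) : (a < n)%N -> c a -> x a <= y a.
Proof.
move=> an ca; apply: le_trans (tw_lower tw an).
rewrite (tw_p_cut tw an ca) lerDl mulr_ge0 // subr_ge0; case: ifP => // nc.
case: (ltnP a.+1 n) => [|na]; first exact: (tw_sorted tw).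
have an' : a.+1 = n by apply/eqP; rewrite eqn_leq an.
by move: nc; rewrite an' (tw_cutn tw).
Qed.

Lemma twist_right_end_le (e : nat) : (e < n)%N -> c e.+1 -> y e <= x e.
Proof.
move=> en ce; apply: le_trans (tw_upper tw en) _.
rewrite (tw_q_cut tw en ce) gerBl mulr_ge0 // subr_ge0; case: ifP => // nc.
by case: e en nc {ce} => [|e] en; [rewrite (tw_cut0 tw)|move=> _; apply: (tw_sorted tw)].
Qed.

Hypothesis rho_le : rho <= 2^-1.
Let rho_le1 : rho <= 1.
Proof. by apply: le_trans rho_le _; rewrite invf_le1 ?ler1n. Qed.

(* The inequality [x - p <= cover] carries the telescoping: passing from index
   k to k + 1 costs x_k - p_k, which is part of the cover already gained. *)
Lemma left_potential_gain (a d : nat) : (a + d < n)%N -> c a ->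
  rho ^+ d * cover c x a d <= \sum_(i < d) rho ^+ i * (y (a + i) - x (a + i)).
Proof.
move=> adn ca.
suff [] : x (a + d) - p (a + d) <= cover c x a d /\
  rho ^+ d * cover c x a d <= \sum_(i < d) rho ^+ i * (y (a + i) - x (a + i)) by [].
elim: d adn => [|d IH] adn.
  by rewrite /cover !big_ord0 addn0 (tw_p_cut tw) ?mulr0 ?subrr //; lia.
have adn' : (a + d < n)%N by lia.
have [pc sc] := IH adn'.
rewrite big_ord_recr /= cover_recr /gap_cover addnS /=.
have low := tw_lower tw adn'.
have rd0 : 0 <= rho ^+ d by rewrite exprn_ge0.
(* With [y] replaced by its lower bound and [rho ^+ d] divided out, both cases below amount to this
   inequality. *)
have slack : 0 <= (1 - rho) * (cover c x a d - (x (a + d) - p (a + d))).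
  by rewrite mulr_ge0 ?subr_ge0.
case: ifP low => cd low.
  split; first by rewrite (tw_p_cut tw) ?subrr ?addr0 ?cover_ge0 //; lia.
  rewrite addr0 exprSr.
  apply: le_trans (lerD sc (ler_wpM2l rd0 (lerB low (lexx _)))).
  rewrite -mulrA -mulrDr ler_wpM2l //; lra.
have pu : p (a + d).+1 = p (a + d) by apply: (tw_p_uncut tw); [lia|rewrite cd].
split; first by rewrite pu; lra.
rewrite exprSr.
apply: le_trans (lerD sc (ler_wpM2l rd0 (lerB low (lexx _)))).
rewrite -mulrA -mulrDr ler_wpM2l //; lra.
Qed.

(** Mirror image: the right end stays fixed and the induction adds ranks on the left, carrying
    [q a - x a <= cover]. *)
Lemma right_potential_gain (a d : nat) : (a + d < n)%N -> c (a + d).+1 ->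
  rho ^+ d * cover c x a d <=
  \sum_(i < d) rho ^+ i * (x (a + d - i) - y (a + d - i)).
Proof.
move=> adn ce.
suff [] : q a - x a <= cover c x a d /\ rho ^+ d * cover c x a d <=
  \sum_(i < d) rho ^+ i * (x (a + d - i) - y (a + d - i)) by [].
elim: d a adn ce => [|d IH] a adn ce.
  rewrite /cover !big_ord0 (tw_q_cut tw) ?mulr0 ?subrr //; [lia|].
  by move: ce; rewrite addn0.
have adn' : (a.+1 + d < n)%N by lia.
have [pc sc] : _ /\ _ := IH _ adn' ltac:(by move: ce; rewrite addnS).
rewrite big_ord_recr /= cover_recl /gap_cover -addSnnS addnK /=.
have an : (a.+1 < n)%N by lia.
have up := tw_upper tw an.
have c0 : 0 <= cover c x a.+1 d by apply: cover_ge0.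
have rd0 : 0 <= rho ^+ d by rewrite exprn_ge0.
have slack : 0 <= (1 - rho) * (cover c x a.+1 d - (q a.+1 - x a.+1)) by rewrite mulr_ge0 ?subr_ge0.
case: ifP up => /= cd up.
  split; first by rewrite (tw_q_cut tw) ?subrr ?add0r //; lia.
  rewrite add0r exprSr.
  apply: le_trans (lerD sc (ler_wpM2l rd0 (lerB (lexx _) up))).
  rewrite -mulrA -mulrDr ler_wpM2l //; lra.
have pu : q a.+1 = q a by apply: (tw_q_uncut tw); [lia|rewrite cd].
split; first by rewrite -pu; lra.
rewrite exprSr.
apply: le_trans (lerD sc (ler_wpM2l rd0 (lerB (lexx _) up))).
rewrite -mulrA -mulrDr ler_wpM2l //; lra.
Qed.
End Step.

(** * Auxiliary bounds on sums *)

Lemma block_energy_cat (R : realType) (s : R) (c : nat -> bool) (q x : nat -> R)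
    (a b e : nat) : (a <= b)%N -> (b <= e)%N ->
  block_energy s c q x a e = block_energy s c q x a b + block_energy s c q x b e.
Proof. by move=> ab be; rewrite /block_energy (@big_cat_nat _ _ _ b). Qed.

Lemma block_energy_ge0 (R : realType) (s : R) (c : nat -> bool) (q x : nat -> R)
    (a b : nat) : 0 <= block_energy s c q x a b.
Proof. by apply: sumr_ge0 => j _; exact: powR_ge0. Qed.

Lemma sum_expr_le2 (R : realType) (rho : R) (k : nat) :
  0 <= rho -> rho <= 2^-1 -> \sum_(i < k) rho ^+ i <= 2.
Proof.
move=> r0 rh; have rk : 0 <= rho ^+ k by rewrite exprn_ge0.
have := subrX1 rho k; set S := \sum_(i < k) _ => E.
have S0 : 0 <= S by apply: sumr_ge0 => i _; rewrite exprn_ge0.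
by nra.
Qed.

(* Each run of [T], except possibly the last one, is followed by a jump of the
   monotone potential [Phi]; this bounds the number of runs. *)
Lemma sum_over_runs (R : realType) (T : pred nat) (E Phi : nat -> R) (W beta : R)
    (t0 t1 : nat) : (t0 <= t1)%N -> 0 < beta -> 0 <= W ->
  (forall t, (t0 <= t < t1)%N -> Phi t <= Phi t.+1) ->
  (forall u v, (t0 <= u)%N -> (u <= v)%N -> (v <= t1)%N ->
    (forall t, (u <= t < v)%N -> T t) -> \sum_(u <= t < v) E t <= W) ->
  (forall t, (t0 <= t)%N -> (t.+1 < t1)%N -> T t -> ~~ T t.+1 ->
    Phi t.+1 + beta <= Phi t.+2) ->
  \sum_(t0 <= t < t1 | T t) E t <= W * (1 + (Phi t1 - Phi t0) / beta).
Proof.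
move=> t01 b0 W0 mono run jump.
(* [u] starts the run still open at [t1]; the runs before it are already charged to jumps of
   [Phi]. *)
have [u [u0 u1 Tu Eu]] : exists u, [/\ (t0 <= u)%N, (u <= t1)%N,
    (forall t, (u <= t < t1)%N -> T t) &
    \sum_(t0 <= t < u | T t) E t <= W * ((Phi t1 - Phi t0) / beta)].
  have : (t1 <= t1)%N by [].
  elim: {-3}t1 t01 => [|v IH] t0v vt1.
    exists 0; split => //.
    move: t0v; rewrite leqn0 => /eqP ->.
    by rewrite big_geq // subrr mul0r mulr0.
  move: t0v; rewrite leq_eqVlt => /orP[/eqP <-|t0v].
    exists t0; split => //; first by move=> t; lia.
    by rewrite big_geq // subrr mul0r mulr0.
  have [u [u0 u1 Tu Eu]] := IH t0v (ltnW vt1).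
  have Pv : Phi v <= Phi v.+1 by apply: mono; lia.
  have Wv : W * ((Phi v - Phi t0) / beta) <= W * ((Phi v.+1 - Phi t0) / beta).
    by rewrite ler_wpM2l // ler_pM2r ?invr_gt0 // lerD2r.
  case Tv : (T v).
    exists u; split => //; [by lia| |exact: le_trans Eu Wv].
    move=> t; rewrite ltnS => /andP[ut]; rewrite leq_eqVlt => /orP[/eqP -> //|tv].
    by apply: Tu; rewrite ut.
  (* A run from [u] to [v], if nonempty, ends here, and the step from [v] to [v.+1] is the jump that
     pays for it. *)
  exists v.+1; split => //; [by lia|by move=> t; lia|].
  rewrite big_mkcond big_nat_recr //= Tv addr0 -big_mkcond.
  move: u1; rewrite leq_eqVlt => /orP[/eqP uv|uv].
    by rewrite -uv; apply: le_trans Eu _; rewrite uv.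
  rewrite (@big_cat_nat _ _ _ u) //=; last by lia.
  have -> : \sum_(u <= t < v | T t) E t = \sum_(u <= t < v) E t.
    rewrite big_nat_cond [RHS]big_nat_cond; apply: eq_bigl => t.
    by case tuv: (u <= t < v)%N => //=; rewrite Tu.
  have Ruv : \sum_(u <= t < v) E t <= W by apply: run => //; lia.
  have vE : v = v.-1.+1 by lia.
  have : Phi v.-1.+1 + beta <= Phi v.-1.+2.
    apply: jump; [by lia|by lia| |by rewrite -vE Tv].
    by apply: Tu; lia.
  rewrite -vE => Pb.
  apply: le_trans (lerD Eu Ruv) _.
  rewrite -[X in _ + X]mulr1 -mulrDr ler_wpM2l //.
  rewrite -[X in _ + X](@divff _ beta) ?gt_eqF // -mulrDl ler_pM2r ?invr_gt0 //; lra.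
rewrite (@big_cat_nat _ _ _ u) //= mulrDr mulr1 addrC lerD //.
apply: le_trans _ (run u t1 u0 u1 (leqnn _) Tu).
rewrite big_nat_cond [leRHS]big_nat_cond (eq_bigl (fun t => (u <= t < t1)%N && true)) //.
by move=> t; case tuv: (u <= t < t1)%N => //=; rewrite Tu.
Qed.

Ltac nat_lia :=
  repeat match goal with
  | H : is_true (@Order.le _ _ _ _) |- _ => clear H
  | H : is_true (@Order.lt _ _ _ _) |- _ => clear H
  | H : forall _, _ |- _ => clear H
  | H : @eq (Real.sort _) _ _ |- _ => clear H
  end; lia.

(** * Potentials and cut gaps over time *)

Section System.
Variables (R : realType) (rho : R) (n : nat).
Hypotheses (rho_gt0 : 0 < rho) (rho_le : rho <= 2^-1).
Variables (c : nat -> nat -> bool) (p q x : nat -> nat -> R).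
Hypothesis tw : forall t, twist_step rho n (c t) (p t) (q t) (x t) (x t.+1).

Let rho_ge0 : 0 <= rho := ltW rho_gt0.
Let r1 : 1 <= rho^-1.
Proof. by rewrite invf_ge1 // (le_trans rho_le) // invf_le1 ?ler1n. Qed.

(** Cuts on both sides let the ranks [a] to [a + d] evolve as a system of their own. The time
    interval is half-open: cuts are required at the steps taken, and not at the time [t1] reached by
    the last one. *)
Definition isolated (t0 t1 a d : nat) : Prop :=
  forall t, (t0 <= t < t1)%N -> c t a /\ c t (a + d).+1.

Lemma isolated_sub (t0 t1 u v a d : nat) : (t0 <= u)%N -> (v <= t1)%N ->
  isolated t0 t1 a d -> isolated u v a d.
Proof. by move=> t0u vt1 iso t tuv; apply: iso; nat_lia. Qed.

Lemma left_end_mono (t0 t1 a d : nat) : isolated t0 t1 a d -> (t0 <= t1)%N ->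
  (a + d < n)%N -> x t0 a <= x t1 a.
Proof.
elim: t1 => [|t1 IH] iso; first by rewrite leqn0 => /eqP ->.
rewrite leq_eqVlt => /orP[/eqP -> //|t01] adn.
apply: le_trans (IH (isolated_sub (leqnn _) (leqnSn _) iso) t01 adn) _.
have [ca _] := iso t1 ltac:(nat_lia).
by apply: (twist_left_end_ge (tw t1) rho_gt0) => //; nat_lia.
Qed.

Lemma right_end_mono (t0 t1 a d : nat) : isolated t0 t1 a d -> (t0 <= t1)%N ->
  (a + d < n)%N -> x t1 (a + d) <= x t0 (a + d).
Proof.
elim: t1 => [|t1 IH] iso; first by rewrite leqn0 => /eqP ->.
rewrite leq_eqVlt => /orP[/eqP -> //|t01] adn.
apply: le_trans _ (IH (isolated_sub (leqnn _) (leqnSn _) iso) t01 adn).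
have [_ ce] := iso t1 ltac:(nat_lia).
by apply: (twist_right_end_le (tw t1) rho_gt0).
Qed.

Definition diam (t a d : nat) : R := x t (a + d) - x t a.

Lemma diam_ge0 (t a d : nat) : (a + d < n)%N -> 0 <= diam t a d.
Proof. by move=> adn; rewrite subr_ge0 (twist_le (tw t)) //; nat_lia. Qed.

Lemma diam_mono (t0 t1 a d : nat) : isolated t0 t1 a d -> (t0 <= t1)%N ->
  (a + d < n)%N -> diam t1 a d <= diam t0 a d.
Proof.
by move=> iso t01 adn; rewrite lerB ?(right_end_mono iso) ?(left_end_mono iso).
Qed.

Definition left_potential (t a k : nat) : R := \sum_(i < k) rho ^+ i * x t (a + i).

(** The weights decay from the right end [e]; the minus sign turns the decrease of the weighted sum
    into growth. *)
Definition right_potential (t e k : nat) : R :=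
  - \sum_(i < k) rho ^+ i * x t (e - i).

Lemma left_potential_step (t a k : nat) : (a + k < n)%N -> c t a ->
  rho ^+ k * cover (c t) (x t) a k <= left_potential t.+1 a k - left_potential t a k.
Proof.
move=> akn ca; apply: le_trans (left_potential_gain (tw t) rho_gt0 rho_le akn ca) _.
by rewrite /left_potential -sumrB; apply: ler_sum => i _; rewrite mulrBr.
Qed.

Lemma right_potential_step (t a k : nat) : (a + k < n)%N -> c t (a + k).+1 ->
  rho ^+ k * cover (c t) (x t) a k <=
  right_potential t.+1 (a + k) k - right_potential t (a + k) k.
Proof.
move=> akn ca; apply: le_trans (right_potential_gain (tw t) rho_gt0 rho_le akn ca) _.
by rewrite /right_potential opprK addrC -sumrB; apply: ler_sum => i _; rewrite mulrBr.
Qed.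

Lemma weighted_sum_le (D : R) (k : nat) (f : nat -> R) : 0 <= D ->
  (forall i, (i < k)%N -> f i <= D) -> \sum_(i < k) rho ^+ i * f i <= 2 * D.
Proof.
move=> D0 fD; apply: (@le_trans _ _ (\sum_(i < k) rho ^+ i * D)).
  by apply: ler_sum => i _; rewrite ler_wpM2l ?exprn_ge0 // fD.
by rewrite -mulr_suml ler_wpM2r // sum_expr_le2.
Qed.

(** The range stays within its initial span, so every rank advances by at most the initial diameter,
    and the weights sum to at most 2. *)
Lemma left_potential_range (t0 t1 a d k : nat) : isolated t0 t1 a d ->
  (t0 <= t1)%N -> (a + d < n)%N -> (k <= d.+1)%N ->
  left_potential t1 a k - left_potential t0 a k <= 2 * diam t0 a d.
Proof.
move=> iso t01 adn kd; rewrite /left_potential -sumrB.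
under eq_bigr => i _ do rewrite -mulrBr.
apply: (weighted_sum_le (f := fun i => x t1 (a + i) - x t0 (a + i))).
  exact: diam_ge0.
move=> i ik; rewrite lerB //; last by rewrite (twist_le (tw t0)) //; nat_lia.
apply: le_trans (right_end_mono iso t01 adn).
by rewrite (twist_le (tw t1)) //; nat_lia.
Qed.

Lemma right_potential_range (t0 t1 a d k : nat) : isolated t0 t1 a d ->
  (t0 <= t1)%N -> (a + d < n)%N -> (k <= d.+1)%N ->
  right_potential t1 (a + d) k - right_potential t0 (a + d) k <= 2 * diam t0 a d.
Proof.
move=> iso t01 adn kd; rewrite /right_potential opprK addrC -sumrB.
under eq_bigr => i _ do rewrite -mulrBr.
apply: (weighted_sum_le (f := fun i => x t0 (a + d - i) - x t1 (a + d - i))).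
  exact: diam_ge0.
move=> i ik; rewrite lerB //; first by rewrite (twist_le (tw t0)) //; nat_lia.
apply: le_trans (left_end_mono iso t01 adn) _.
by rewrite (twist_le (tw t1)) //; nat_lia.
Qed.

(** Every step gains at least [rho ^+ k] times the cover, and the gains telescope to at most twice
    the diameter. *)
Lemma left_cover_sum (t0 t1 a d k : nat) : isolated t0 t1 a d -> (t0 <= t1)%N ->
  (a + d < n)%N -> (k <= d)%N ->
  \sum_(t0 <= t < t1) cover (c t) (x t) a k <= 2 * rho^-1 ^+ k * diam t0 a d.
Proof.
move=> iso t01 adn kd.
rewrite mulrAC exprVn ler_pdivlMr ?exprn_gt0 // mulrC mulr_sumr.
apply: le_trans (left_potential_range iso t01 adn (leqW kd)).
rewrite -(telescope_sumr (fun t => left_potential t a k) t01); apply: ler_sum_nat => t tt.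
by apply: left_potential_step; [nat_lia|case: (iso t tt)].
Qed.

Lemma right_cover_sum (t0 t1 a d k : nat) : isolated t0 t1 a d -> (t0 <= t1)%N ->
  (a + d < n)%N -> (k <= d)%N ->
  \sum_(t0 <= t < t1) cover (c t) (x t) (a + (d - k)) k <=
  2 * rho^-1 ^+ k * diam t0 a d.
Proof.
move=> iso t01 adn kd.
rewrite mulrAC exprVn ler_pdivlMr ?exprn_gt0 // mulrC mulr_sumr.
apply: le_trans (right_potential_range iso t01 adn (leqW kd)).
rewrite -(telescope_sumr (fun t => right_potential t (a + d) k) t01); apply: ler_sum_nat => t tt.
have -> : (a + d = a + (d - k) + k)%N by nat_lia.
apply: right_potential_step; first by nat_lia.
by rewrite -addnA subnK //; case: (iso t tt).
Qed.

Lemma system_isolated (t0 t1 : nat) : (0 < n)%N -> isolated t0 t1 0 n.-1.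
Proof.
by move=> n0 t _; rewrite add0n prednK //; split; [exact: (tw_cut0 (tw t))|exact: (tw_cutn (tw t))].
Qed.

Lemma energy1_bound (T : nat) : (1 < n)%N ->
  \sum_(0 <= t < T) block_energy 1 (c t) (q t) (x t) 0 n <=
  4 * rho^-1 ^+ n./2 * diam 0 0 n.-1.
Proof.
move=> n1; have n0 : (0 < n)%N by nat_lia.
have iso := @system_isolated 0 T n0.
have hn : (n./2 <= n.-1)%N by nat_lia.
have n1n : (0 + n.-1 < n)%N by nat_lia.
(* The cover is divided at rank [n./2]. The right part has [n.-1 - n./2 <= n./2] gaps, so either
   potential costs at most a factor [rho^-1 ^+ n./2]. *)
apply: (@le_trans _ _ (\sum_(0 <= t < T) cover (c t) (x t) 0 n./2 +
    \sum_(0 <= t < T) cover (c t) (x t) (0 + (n.-1 - (n.-1 - n./2))) (n.-1 - n./2))).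
  rewrite -big_split /= ; apply: ler_sum_nat => t tT.
  have [ca ce] := iso t tT.
  rewrite -{1}(prednK n0) -[n.-1]add0n (block_energy1 (tw t)) //.
  rewrite subKn // -cover_cat subnKC //.
apply: le_trans (lerD (left_cover_sum iso _ n1n hn) (right_cover_sum iso _ n1n _)) _ => //.
  by nat_lia.
have : rho^-1 ^+ (n.-1 - n./2) <= rho^-1 ^+ n./2 by rewrite ler_weXn2l //; nat_lia.
move=> /(ler_wpM2r (diam_ge0 0 n1n)); lra.
Qed.

Definition wide_cut (th : R) (j t : nat) : bool :=
  c t j.+1 && (th <= x t j.+1 - x t j).

(* A cut gap only widens, so a run of [wide_cut] ends because an edge covers
   the wide gap, which costs a definite amount of either potential. *)
Lemma sum_wide_cut (t0 t1 a d i : nat) (th W : R) (E : nat -> R) :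
  isolated t0 t1 a d -> (t0 <= t1)%N -> (a + d < n)%N -> (i < d)%N ->
  0 < th -> 0 <= W ->
  (forall u v, (t0 <= u)%N -> (u <= v)%N -> (v <= t1)%N ->
    (forall t, (u <= t < v)%N -> wide_cut th (a + i) t) ->
    \sum_(u <= t < v) E t <= W) ->
  \sum_(t0 <= t < t1 | wide_cut th (a + i) t) E t <=
  W * (1 + 2 * diam t0 a d * rho^-1 ^+ minn i.+1 (d - i) / th).
Proof.
move=> iso t01 adn id th0 W0 run.
have ain : ((a + i).+1 < n)%N by nat_lia.
have covered t : wide_cut th (a + i) t -> ~~ wide_cut th (a + i) t.+1 ->
    th <= gap_cover (c t.+1) (x t.+1) (a + i).+1.
  move=> /andP[ct tht].
  have wide : th <= x t.+1 (a + i).+1 - x t.+1 (a + i).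
    apply: le_trans tht _; rewrite lerB //.
      exact: (twist_left_end_ge (tw t)).
    by apply: (twist_right_end_le (tw t)) => //; nat_lia.
  by rewrite /wide_cut wide andbT /gap_cover => /negbTE ->.
(* Common to both cases: if covering the wide gap raises a potential by [rho ^+ k * th], the range
   of the potential limits the number of such jumps. *)
have bound k Phi : (forall t, (t0 <= t < t1)%N -> Phi t <= Phi t.+1) ->
    (forall t, (t0 <= t)%N -> (t.+1 < t1)%N -> wide_cut th (a + i) t ->
      ~~ wide_cut th (a + i) t.+1 -> Phi t.+1 + rho ^+ k * th <= Phi t.+2) ->
    Phi t1 - Phi t0 <= 2 * diam t0 a d ->
    \sum_(t0 <= t < t1 | wide_cut th (a + i) t) E t <=
    W * (1 + 2 * diam t0 a d * rho^-1 ^+ k / th).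
  move=> mono jump range.
  have b0 : 0 < rho ^+ k * th by rewrite mulr_gt0 ?exprn_gt0.
  apply: le_trans (sum_over_runs t01 b0 W0 mono run jump) _.
  rewrite ler_wpM2l // lerD2l exprVn -mulrA -invfM ler_pM2r ?invr_gt0 //.
(* Counted from the left end the gap has number [i.+1], from the right end [d - i]; the nearer end
   gives the smaller exponent. *)
rewrite minnE; case: (ltnP (d - i) i.+1) => [di|di].
  have -> : (i.+1 - (i.+1 - (d - i)) = d - i)%N by nat_lia.
  have aE : (a + i + (d - i) = a + d)%N by nat_lia.
  have step t : (t0 <= t < t1)%N -> rho ^+ (d - i) * cover (c t) (x t) (a + i) (d - i) <=
      right_potential t.+1 (a + d) (d - i) - right_potential t (a + d) (d - i).
    move=> tt; have [_ ce] := iso t tt.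
    by rewrite -aE; apply: right_potential_step; rewrite aE.
  apply: (bound _ (fun t => right_potential t (a + d) (d - i))).
  - move=> t tt; rewrite -subr_ge0; apply: le_trans (step t tt).
    by rewrite mulr_ge0 ?exprn_ge0 ?(cover_ge0 (tw t)) // aE.
  - move=> t tt0 tt1 Tt Tt'; rewrite addrC -lerBrDr.
    apply: le_trans (step t.+1 ltac:(nat_lia)).
    rewrite ler_wpM2l ?exprn_ge0 //; apply: le_trans (covered t Tt Tt') _.
    have -> : (d - i = (d - i).-1.+1)%N by nat_lia.
    by rewrite cover_recl lerDl (cover_ge0 (tw t.+1)) //; nat_lia.
  - by apply: right_potential_range => //; nat_lia.
have -> : (i.+1 - (i.+1 - (d - i)) = i.+1)%N by nat_lia.
have step t : (t0 <= t < t1)%N -> rho ^+ i.+1 * cover (c t) (x t) a i.+1 <=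
    left_potential t.+1 a i.+1 - left_potential t a i.+1.
  move=> tt; have [ca _] := iso t tt.
  by apply: left_potential_step => //; nat_lia.
apply: (bound _ (fun t => left_potential t a i.+1)).
- move=> t tt; rewrite -subr_ge0; apply: le_trans (step t tt).
  by rewrite mulr_ge0 ?exprn_ge0 ?(cover_ge0 (tw t)) //; nat_lia.
- move=> t tt0 tt1 Tt Tt'; rewrite addrC -lerBrDr.
  apply: le_trans (step t.+1 ltac:(nat_lia)).
  rewrite ler_wpM2l ?exprn_ge0 //; apply: le_trans (covered t Tt Tt') _.
  by rewrite cover_recr lerDr (cover_ge0 (tw t.+1)) //; nat_lia.
- by apply: left_potential_range => //; nat_lia.
Qed.

(** * The s-energy, by induction on the number of blocks *)

Variable s : R.
Hypothesis s_gt0 : 0 < s.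

Let energy (t a d : nat) : R := block_energy s (c t) (q t) (x t) a (a + d).+1.

(** In an isolated range this is the number of blocks: each is counted at its leftmost rank, and the
    closing cut at [(a + d).+1] is left out. *)
Definition cuts (t a d : nat) : nat := \sum_(a <= j < (a + d).+1) c t j.

(* At each time either blocks cover a quarter of [D0], or some cut gap is wide
   and splits the system into two with fewer components. *)
Lemma energy_one_scale (m M N a d t0 t1 : nat) (kappa D0 : R) :
  1 <= kappa -> (m < M)%N -> (d < N)%N -> (a + d < n)%N -> 0 < D0 ->
  (forall a d u v, (a + d < n)%N -> (d < N)%N -> (u <= v)%N -> isolated u v a d ->
    (forall t, (u <= t < v)%N -> (cuts t a d <= m)%N) ->
    \sum_(u <= t < v) energy t a d <= kappa * rho^-1 ^+ d * diam u a d `^ s) ->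
  (t0 <= t1)%N -> isolated t0 t1 a d ->
  (forall t, (t0 <= t < t1)%N -> (cuts t a d <= m.+1)%N) ->
  (forall t, (t0 <= t < t1)%N -> D0 / 2 <= diam t a d) -> diam t0 a d <= D0 ->
  \sum_(t0 <= t < t1) energy t a d <=
  26 * M%:R * N%:R * kappa * rho^-1 ^+ d * D0 `^ s.
Proof.
move=> k1 mM dN adn D00 IH t01 iso cm Dlow Dup.
have M1 : 1 <= M%:R :> R by rewrite ler1n; nat_lia.
have N1 : 1 <= N%:R :> R by rewrite ler1n; nat_lia.
have M0 : 0 < M%:R :> R by lra.
have P0 : 0 <= D0 `^ s by exact: powR_ge0.
(* Cut gaps below this width, at most [M] in number, leave at most [D0 / 4] uncovered; as the
   diameter is at least [D0 / 2], blocks then cover [D0 / 4]. *)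
set th := D0 / (4 * M%:R).
have th0 : 0 < th by rewrite divr_gt0 // mulr_gt0.
have Mth : M%:R * th = D0 / 4 by rewrite /th; field; rewrite gt_eqF.
have E0 t : 0 <= energy t a d by exact: block_energy_ge0.
(* Energy is charged to a wide cut if there is one, else to the cover. The coefficient of the cover
   is the energy bound, [M] times the s-th power of [D0], divided by [D0 / 4]. *)
have split_time t : (t0 <= t < t1)%N -> energy t a d <=
    4 * M%:R * D0 `^ s / D0 * cover (c t) (x t) a d +
    \sum_(i < d) (if wide_cut th (a + i) t then energy t a d else 0).
  move=> tt; have [ca ce] := iso t tt.
  have cov0 : 0 <= cover (c t) (x t) a d by exact: (cover_ge0 (tw t)).
  have F0 : 0 <= 4 * M%:R * D0 `^ s / D0.
    by rewrite divr_ge0 ?(ltW D00) // mulr_ge0 // mulr_ge0 // ltW.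
  have [/existsP[i Ti]|/existsPn noT] := boolP [exists i : 'I_d, wide_cut th (a + i) t].
    rewrite (bigD1 i) //= Ti.
    have := mulr_ge0 F0 cov0.
    have : 0 <= \sum_(k < d | k != i)
        (if wide_cut th (a + k) t then energy t a d else 0).
      by apply: sumr_ge0 => k _; case: ifP.
    by lra.
  have Dcov : diam t a d <= cover (c t) (x t) a d + M%:R * th.
    rewrite /diam; apply: diameter_cover; first exact: ltW.
      move=> i id cti; have := noT (Ordinal id).
      by rewrite /wide_cut /= cti /= -ltNge => /ltW.
    exact: leq_trans (cm t tt) mM.
  have lo := Dlow t tt.
  have Dt : diam t a d <= D0.
    apply: le_trans Dup; apply: diam_mono => //; last by nat_lia.
    by apply: isolated_sub iso => //; nat_lia.
  have cov4 : D0 / 4 <= cover (c t) (x t) a d by move: Dcov; rewrite Mth; lra.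
  apply: (@le_trans _ _ (M%:R * D0 `^ s)).
    apply: le_trans (block_energy_le (tw t) (ltW s_gt0) adn ce (cm t tt)) _.
    rewrite ler_pM ?ler0n ?powR_ge0 ?ler_nat //.
    by rewrite ge0_ler_powR ?nnegrE ?(ltW s_gt0) ?(ltW D00) ?diam_ge0.
  rewrite -[leLHS]addr0 lerD //; last by apply: sumr_ge0 => k _; case: ifP.
  apply: le_trans (ler_wpM2l F0 cov4).
  by rewrite le_eqVlt; apply/orP; left; apply/eqP; field; rewrite gt_eqF.
have gap_cost i : (i < d)%N ->
    \sum_(t0 <= t < t1 | wide_cut th (a + i) t) energy t a d <=
    18 * M%:R * kappa * rho^-1 ^+ d * D0 `^ s.
  move=> id.
  have kap0 : 0 <= kappa by lra.
  have rr k : 0 <= rho^-1 ^+ k by rewrite exprn_ge0 // invr_ge0.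
  (* [W] bounds one run: while the gap stays cut, its two sides are isolated and [IH] applies to
     each. *)
  set W := kappa * rho^-1 ^+ i * D0 `^ s + kappa * rho^-1 ^+ (d - i.+1) * D0 `^ s.
  have W0 : 0 <= W by rewrite addr_ge0 // !mulr_ge0.
  have run u v : (t0 <= u)%N -> (u <= v)%N -> (v <= t1)%N ->
      (forall t, (u <= t < v)%N -> wide_cut th (a + i) t) ->
      \sum_(u <= t < v) energy t a d <= W.
    move=> t0u uv vt1 Tuv.
    have isoL : isolated u v a i.
      move=> t tuv; have [ca _] := iso t ltac:(nat_lia).
      by have /andP[] := Tuv t tuv.
    have isoR : isolated u v (a + i).+1 (d - i.+1).
      move=> t tuv; have [_ ce] := iso t ltac:(nat_lia).
      have -> : ((a + i).+1 + (d - i.+1) = a + d)%N by nat_lia.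
      by have /andP[] := Tuv t tuv.
    have aE : ((a + i).+1 + (d - i.+1) = a + d)%N by nat_lia.
    have cutsE t : cuts t a d = (cuts t a i + cuts t (a + i).+1 (d - i.+1))%N.
      by rewrite /cuts aE (@big_cat_nat _ _ _ (a + i).+1) //=; nat_lia.
    have Du : diam u a d <= D0.
      apply: le_trans Dup; apply: diam_mono => //; apply: isolated_sub iso => //; nat_lia.
    have xs k : (k <= d)%N -> x u a <= x u (a + k) <= x u (a + d).
      by move=> kd; rewrite !(twist_le (tw u)) //; nat_lia.
    (* Each side has at least one cut, at its leftmost rank, which leaves at most [m] for the other
       side. *)
    have pos j : (a <= j <= a + d)%N -> forall t, (u <= t < v)%N -> c t j ->
        forall b e, (b <= j < (b + e).+1)%N -> (0 < cuts t b e)%N.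
      move=> aj t tuv ctj b e /andP[bj je].
      by rewrite /cuts (big_cat_nat bj (ltnW je)) /= [X in (_ + X)%N]big_ltn //= ctj; nat_lia.
    have Ecat t : energy t a d = energy t a i + energy t (a + i).+1 (d - i.+1).
      by rewrite /energy aE; apply: block_energy_cat; nat_lia.
    rewrite (eq_bigr _ (fun t _ => Ecat t)).
    rewrite big_split lerD //.
    - apply: le_trans (IH a i u v _ _ uv isoL _) _; [by nat_lia|by nat_lia| |].
        move=> t tuv; have := cm t ltac:(nat_lia); rewrite cutsE.
        have /andP[cti _] := Tuv t tuv.
        have := pos (a + i).+1 ltac:(nat_lia) t tuv cti (a + i).+1 (d - i.+1)%N.
        by move=> /(_ ltac:(nat_lia)); nat_lia.
      rewrite ler_wpM2l ?mulr_ge0 // ge0_ler_powR ?nnegrE ?(ltW s_gt0) ?(ltW D00) //.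
        by apply: diam_ge0; nat_lia.
      by apply: le_trans Du; rewrite lerB //; case/andP: (xs i (ltnW id)).
    - have := IH (a + i).+1 (d - i.+1)%N u v ltac:(nat_lia) ltac:(nat_lia) uv isoR.
      move=> IH'; apply: le_trans (IH' _) _.
        move=> t tuv; have := cm t ltac:(nat_lia); rewrite cutsE.
        have [ca _] := iso t ltac:(nat_lia).
        by have := pos a ltac:(nat_lia) t tuv ca a i ltac:(nat_lia); nat_lia.
      rewrite ler_wpM2l ?mulr_ge0 // ge0_ler_powR ?nnegrE ?(ltW s_gt0) ?(ltW D00) //.
        by apply: diam_ge0; nat_lia.
      rewrite /diam aE; apply: le_trans Du; rewrite lerB // -addnS.
      by case/andP: (xs i.+1 id).
  apply: le_trans (sum_wide_cut iso t01 adn id th0 W0 run) _.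
  (* [l] is the larger of [i] and [d - i.+1]: a run costs a factor [rho^-1 ^+ l], the number of runs
     a factor [rho^-1 ^+ k], and [k + l = d]. *)
  set k := minn _ _; pose l := (d - k)%N.
  have rk : 1 <= rho^-1 ^+ k by rewrite exprn_ege1.
  have Wl : W <= 2 * kappa * rho^-1 ^+ l * D0 `^ s.
    have ri : rho^-1 ^+ i <= rho^-1 ^+ l by rewrite ler_weXn2l // /l /k; nat_lia.
    have rd : rho^-1 ^+ (d - i.+1) <= rho^-1 ^+ l by rewrite ler_weXn2l // /l /k; nat_lia.
    have := ler_wpM2r P0 (ler_wpM2l kap0 ri).
    have := ler_wpM2r P0 (ler_wpM2l kap0 rd).
    by rewrite /W; lra.
  have runs : 1 + 2 * diam t0 a d * rho^-1 ^+ k / th <= 9 * M%:R * rho^-1 ^+ k.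
    have : 2 * diam t0 a d * rho^-1 ^+ k / th <= 8 * M%:R * rho^-1 ^+ k.
      rewrite ler_pdivrMr //.
      have -> : 8 * M%:R * rho^-1 ^+ k * th = 2 * D0 * rho^-1 ^+ k.
        by rewrite mulrAC -[8 * M%:R * th]mulrA Mth; field.
      by rewrite ler_wpM2r // ler_wpM2l.
    have : 1 <= M%:R * rho^-1 ^+ k by rewrite mulr_ege1.
    by lra.
  have runs0 : 0 <= 1 + 2 * diam t0 a d * rho^-1 ^+ k / th.
    by rewrite addr_ge0 // divr_ge0 ?(ltW th0) // !mulr_ge0 // diam_ge0.
  apply: le_trans (ler_pM W0 runs0 Wl runs) _.
  have -> : rho^-1 ^+ d = rho^-1 ^+ l * rho^-1 ^+ k by rewrite -exprD subnK // /k; nat_lia.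
  by rewrite le_eqVlt; apply/orP; left; apply/eqP; ring.
apply: le_trans (ler_sum_nat split_time) _.
rewrite big_split /= -mulr_sumr [X in _ + X]exchange_big /=.
have covs : \sum_(t0 <= t < t1) cover (c t) (x t) a d <= 2 * rho^-1 ^+ d * D0.
  apply: le_trans (left_cover_sum iso t01 adn (leqnn _)) _.
  by rewrite ler_wpM2l // mulr_ge0 // exprn_ge0 // invr_ge0.
have kap0 : 0 <= kappa by lra.
have Q0 : 0 <= rho^-1 ^+ d * D0 `^ s by rewrite mulr_ge0 // exprn_ge0 // invr_ge0.
have part1 : 4 * M%:R * D0 `^ s / D0 * \sum_(t0 <= t < t1) cover (c t) (x t) a d <=
    8 * M%:R * (rho^-1 ^+ d * D0 `^ s).
  apply: le_trans (ler_wpM2l _ covs) _.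
    by rewrite divr_ge0 ?(ltW D00) // mulr_ge0 // mulr_ge0 // ltW.
  rewrite le_eqVlt; apply/orP; left; apply/eqP.
  by set r := rho^-1 ^+ d; field; rewrite gt_eqF.
have part2 : \sum_(i < d) \sum_(t0 <= t < t1)
      (if wide_cut th (a + i) t then energy t a d else 0) <=
    N%:R * (18 * M%:R * kappa * (rho^-1 ^+ d * D0 `^ s)).
  apply: (@le_trans _ _ (\sum_(i < d) (18 * M%:R * kappa * rho^-1 ^+ d * D0 `^ s))).
    by apply: ler_sum => i _; rewrite -big_mkcond; apply: gap_cost.
  rewrite sumr_const card_ord -[leLHS]mulr_natl -!mulrA ler_wpM2r //.
    by rewrite mulr_ge0 // mulr_ge0 // mulr_ge0.
  by rewrite ler_nat ltnW.
apply: le_trans (lerD part1 part2) _.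
(* This gives [8 + 18 * N * kappa <= 26 * N * kappa], whence the constant 26. *)
have NK : 1 <= N%:R * kappa by rewrite mulr_ege1.
have := ler_wpM2r (mulr_ge0 (ltW M0) Q0) NK.
by lra.
Qed.

(** Young's inequality for the product of this power with 1, with conjugate exponents [s^-1] and
    [(1 - s)^-1]. The case [s = 1], where the second one degenerates, is separate. *)
Lemma powR_half_le : s <= 1 -> 2^-1 `^ s <= 1 - s / 2.
Proof.
move=> s1; have [->|sn1] := eqVneq s 1; first by rewrite powRr1 ?invr_ge0 //; lra.
have s1' : 0 < 1 - s by rewrite subr_gt0 lt_neqAle sn1.
have := @conjugate_powR R (2^-1 `^ s) 1 s^-1 (1 - s)^-1 (powR_ge0 _ _) ler01.
rewrite !invr_gt0 !invrK => /(_ s_gt0 s1' _).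
rewrite -powRrM divff ?gt_eqF // powRr1 ?invr_ge0 // powR1 mulr1 mul1r.
by move=> /(_ ltac:(ring)); lra.
Qed.

(** Outer induction on the number of blocks, inner induction on the number of steps left. [M] and
    [N] stay fixed so that [K] is the same at every level. *)
Lemma energy_bound (m M N : nat) : s <= 1 -> (m <= M)%N -> (0 < N)%N ->
  forall a d u v, (a + d < n)%N -> (d < N)%N -> (u <= v)%N -> isolated u v a d ->
    (forall t, (u <= t < v)%N -> (cuts t a d <= m)%N) ->
    \sum_(u <= t < v) energy t a d <=
    (52 * M%:R * N%:R / s) ^+ m * rho^-1 ^+ d * diam u a d `^ s.
Proof.
move=> s1 mM N0; set K := 52 * M%:R * N%:R / s.
elim: m mM => [|m IH] mM a d u v adn dN uv iso cm.
  (* An isolated range has a cut at [a], so with zero cuts no step can be taken. *)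
  suff -> : u = v.
    by rewrite big_geq // expr0 mul1r mulr_ge0 ?powR_ge0 // exprn_ge0 // invr_ge0.
  apply/eqP; rewrite eqn_leq uv leqNgt /=; apply/negP => ltuv.
  have uu : (u <= u < v)%N by rewrite leqnn.
  have [ca _] := iso u uu.
  have ad : (a < (a + d).+1)%N by rewrite ltnS leq_addr.
  by have := cm u uu; rewrite /cuts (big_ltn ad) ca.
have M1 : 1 <= M%:R :> R by rewrite ler1n; nat_lia.
have N1 : 1 <= N%:R :> R by rewrite ler1n.
have MN1 : 1 <= M%:R * N%:R :> R by rewrite mulr_ege1.
have K1 : 1 <= K.
  by rewrite /K ler_pdivlMr // mul1r -mulrA; lra.
have k1 : 1 <= K ^+ m by rewrite exprn_ege1.
have rd0 : 0 <= rho^-1 ^+ d by rewrite exprn_ge0 // invr_ge0.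
set B := 26 * M%:R * N%:R * K ^+ m * rho^-1 ^+ d.
have B0 : 0 <= B by rewrite !mulr_ge0 // (le_trans ler01).
(* [B] is the cost of one scale, and [2 / s] accounts for the sum over all scales; this is why [K]
   has 52, twice 26. *)
have KB : K ^+ m.+1 * rho^-1 ^+ d = 2 / s * B.
  rewrite exprS /B {1}/K; set y := K ^+ m; set z := rho^-1 ^+ d.
  by field; rewrite gt_eqF.
have Bs : B <= 2 / s * B.
  by rewrite ler_peMl // ler_pdivlMr // mul1r; lra.
rewrite KB.
have [k] : exists k, (v - u <= k)%N by exists (v - u)%N.
elim: k u uv iso cm => [|k IHk] u uv iso cm vuk.
  rewrite big_geq; last by rewrite -subn_eq0 -leqn0.
  by rewrite mulr_ge0 ?powR_ge0 // (le_trans B0).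
have D0 := diam_ge0 u adn.
(* With diameter 0 there is no scale to work at: the diameter stays 0, and so does the energy. *)
have [Dz|Dn] := eqVneq (diam u a d) 0.
  rewrite big_nat_cond big1 => [|t /andP[/andP[ut tv] _]].
    by rewrite mulr_ge0 ?powR_ge0 // (le_trans B0).
  have tuv : (u <= t < v)%N by rewrite ut.
  have Dt : diam t a d = 0.
    apply/eqP; rewrite eq_le diam_ge0 // andbT -Dz diam_mono //.
    by apply: isolated_sub iso => //; exact: ltnW.
  have [_ ce] := iso t tuv.
  apply/eqP; rewrite eq_le block_energy_ge0 andbT.
  apply: le_trans (block_energy_le (tw t) (ltW s_gt0) adn ce (cm t tuv)) _.
  by rewrite -/(diam t a d) Dt powR0 ?gt_eqF // mulr0.
have Dp : 0 < diam u a d by rewrite lt_neqAle eq_sym Dn.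
(* [w] below is the first time at which the diameter is less than half its value at [u], or [v] if
   this does not happen earlier. *)
pose P t := (v <= t)%N || ((u <= t)%N && (diam t a d < diam u a d / 2)).
have exP : exists t, P t by exists v; rewrite /P leqnn.
case: (ex_minnP exP) => w Pw wmin.
have wv : (w <= v)%N by apply: wmin; rewrite /P leqnn.
have uw : (u <= w)%N by move: Pw => /orP[|/andP[]//]; exact: leq_trans.
have low t : (u <= t < w)%N -> diam u a d / 2 <= diam t a d.
  move=> /andP[ut tw']; rewrite leNgt; apply/negP => Dt.
  by have := wmin t; rewrite /P ut Dt orbT => /(_ isT); rewrite leqNgt tw'.
have phase : \sum_(u <= t < w) energy t a d <= B * diam u a d `^ s.
  apply: energy_one_scale (IH (ltnW mM)) uw _ _ low _ => //.
    exact: isolated_sub iso.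
  by move=> t tuw; apply: cm; nat_lia.
have Ds0 : 0 <= diam u a d `^ s by exact: powR_ge0.
move: wv; rewrite leq_eqVlt => /orP[/eqP wv|wv].
  by rewrite -wv; apply: le_trans phase _; rewrite ler_wpM2r.
have Dw : diam w a d < diam u a d / 2.
  by move: Pw; rewrite /P leqNgt wv /= => /andP[].
have {uw} uw : (u < w)%N.
  rewrite ltn_neqAle uw andbT; apply/eqP => uw'.
  by move: Dw; rewrite -uw'; lra.
have rest : \sum_(w <= t < v) energy t a d <= 2 / s * B * diam w a d `^ s.
  apply: IHk; [exact: ltnW| | |by nat_lia].
    by apply: isolated_sub iso => //; exact: ltnW.
  by move=> t tuw; apply: cm; nat_lia.
rewrite (@big_cat_nat _ _ _ w) ?(ltnW uw) ?(ltnW wv) //=.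
have Dws : diam w a d `^ s <= 2^-1 `^ s * diam u a d `^ s.
  rewrite -powRM ?invr_ge0 // ge0_ler_powR ?nnegrE ?(ltW s_gt0) ?diam_ge0 //.
    by rewrite mulr_ge0 ?invr_ge0.
  by rewrite mulrC ltW.
have C0 : 0 <= 2 / s * B by rewrite (le_trans B0).
apply: le_trans (lerD phase (le_trans rest (ler_wpM2l C0 (le_trans Dws
  (ler_wpM2r Ds0 (powR_half_le s1)))))) _.
(* The first phase and the rest add up exactly: [B + 2 / s * B * (1 - s / 2) = 2 / s * B]. *)
rewrite le_eqVlt; apply/orP; left; apply/eqP.
by field; rewrite gt_eqF.
Qed.

Lemma total_energy_bound (m T : nat) : s <= 1 -> (1 < n)%N ->
  (forall t, (\sum_(0 <= j < n) c t j <= m)%N) ->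
  \sum_(0 <= t < T) block_energy s (c t) (q t) (x t) 0 n <=
  (52 * m%:R * n%:R / s) ^+ m * rho^-1 ^+ n.-1 * diam 0 0 n.-1 `^ s.
Proof.
move=> s1 n1 cm; have n0 : (0 < n)%N by exact: ltnW.
have := @energy_bound m m n s1 (leqnn _) n0 0 n.-1 0 T.
rewrite /energy /cuts add0n prednK // => /(_ (leqnn _) (leqnn _) (leq0n _)).
by apply; [exact: system_isolated|].
Qed.
End System.

(** * Sorting the agents *)

Lemma fsum_le_seq (R : realType) (T : choiceType) (A : set T) (r : seq T) (F : T -> R) :
  (forall i, 0 <= F i) -> (forall i, A i -> i \in r) ->
  \sum_(i \in A) F i <= \sum_(i <- r) F i.
Proof.
move=> F0 Ar; pose r' := [seq i <- undup r | i \in A].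
rewrite (fsbigE r') ?filter_uniq ?undup_uniq //; first last.
- by move=> i Ai; rewrite mem_filter mem_undup Ar // mem_set.
- by move=> i /=; rewrite mem_filter => /andP[/set_mem].
rewrite big_filter_cond.
apply: (@le_trans _ _ (\sum_(i <- undup r) F i)).
  by rewrite big_mkcond; apply: ler_sum => i _; case: ifP.
elim: r {Ar r'} => //= i r IH; rewrite big_cons; case: ifP => _.
  by apply: le_trans IH _; rewrite lerDr.
by rewrite big_cons lerD2l.
Qed.

(** Ranks are plain natural numbers, for index arithmetic; only the values of [sigma] below [n] are
    constrained. *)
Definition sorts (R : realType) (n : nat) (x : 'I_n -> R) (sigma : nat -> 'I_n) : Prop :=
  [/\ forall i j, (i <= j)%N -> (j < n)%N -> x (sigma i) <= x (sigma j),
      forall i j, (i < n)%N -> (j < n)%N -> sigma i = sigma j -> i = j &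
      forall i, exists2 k, (k < n)%N & sigma k = i].

Lemma sorts_exists (R : realType) (n : nat) (x : 'I_n -> R) : (0 < n)%N ->
  exists sigma, sorts x sigma.
Proof.
case: n x => // n x _.
pose e := sort (fun i j => x i <= x j) (enum 'I_n.+1).
have se : size e = n.+1 by rewrite size_sort size_enum_ord.
exists (nth ord0 e); split.
- move=> i j ij jn.
  have tr : transitive (fun i j => x i <= x j) by move=> a b c; exact: le_trans.
  have rf : reflexive (fun i j => x i <= x j) by move=> a; exact: lexx.
  have so : sorted (fun i j => x i <= x j) e.
    by apply: sort_sorted => a b; exact: le_total.
  apply: (sorted_leq_nth tr rf ord0 so) => //; rewrite inE se //.
  exact: leq_ltn_trans jn.
- move=> i j iN jN /eqP; rewrite nth_uniq ?se // ?sort_uniq ?enum_uniq //.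
  by move/eqP.
- move=> i; have ie : i \in e by rewrite mem_sort mem_enum.
  by exists (index i e); [have := index_mem i e; rewrite se ie|rewrite nth_index].
Qed.

(** * Order statistics and the pigeonhole principle *)

Section OrderStatistics.
Variables (R : realType) (n : nat) (y : 'I_n -> R) (tau : nat -> 'I_n).
Hypothesis ytau : sorts y tau.

Lemma pigeonhole (f : nat -> 'I_n) :
  ~ (forall i j, (i < j)%N -> (j <= n)%N -> f i <> f j).
Proof.
move=> inj; pose F (i : 'I_n.+1) := f i.
have injF : injective F.
  move=> i j Fij; apply: val_inj => /=; apply/eqP; case: (ltngtP i j) => // ij.
    by case: (inj i j ij); [rewrite -ltnS ltn_ord|exact: Fij].
  by case: (inj j i ij); [rewrite -ltnS ltn_ord|exact: esym Fij].
by have := leq_card F injF; rewrite !card_ord ltnn.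
Qed.

(** Otherwise [tau 0] to [tau j], with values below [B], and the [n - j] agents [h j] to [h n.-1]
    would be [n + 1] distinct agents. *)
Lemma order_stat_ge (h : nat -> 'I_n) (B : R) (j : nat) : (j < n)%N ->
  (forall k l, (j <= k)%N -> (k < l)%N -> (l < n)%N -> h k <> h l) ->
  (forall k, (j <= k < n)%N -> B <= y (h k)) -> B <= y (tau j).
Proof.
move=> jn hinj hB; rewrite leNgt; apply/negP => yB.
have [mono inj _] := ytau.
apply: (@pigeonhole (fun i => if (i <= j)%N then tau i else h i.-1)) => a b ab bn /=.
case: (leqP a j) => aj; case: (leqP b j) => bj.
- by move=> /inj e; move: ab; rewrite e ?ltnn //; lia.
- move=> e; have := hB b.-1 ltac:(lia); rewrite -e leNgt.
  by rewrite (le_lt_trans _ yB) // mono.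
- by lia.
- by apply: hinj; lia.
Qed.

Lemma order_stat_le (h : nat -> 'I_n) (B : R) (j : nat) : (j < n)%N ->
  (forall k l, (k < l)%N -> (l <= j)%N -> h k <> h l) ->
  (forall k, (k <= j)%N -> y (h k) <= B) -> y (tau j) <= B.
Proof.
move=> jn hinj hB; rewrite leNgt; apply/negP => yB.
have [mono inj _] := ytau.
apply: (@pigeonhole (fun i => if (i <= j)%N then h i else tau i.-1)) => a b ab bn /=.
case: (leqP a j) => aj; case: (leqP b j) => bj.
- exact: hinj.
- move=> e; have := hB a aj; rewrite e leNgt.
  by rewrite (lt_le_trans yB) // mono //; lia.
- by lia.
- by move=> /inj e; have := e ltac:(lia) ltac:(lia); lia.
Qed.
End OrderStatistics.

(** * Weighted averages *)

Section Average.
Variables (R : realType) (n : nat) (rho : R) (w x : 'I_n -> R).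
Hypotheses (w_ge0 : forall j, 0 <= w j) (w_sum : \sum_j w j = 1).
Hypothesis w_rho : forall j, w j != 0 -> rho <= w j.

(** After subtracting [lb] every term is nonnegative, and the term of [k] alone yields the gain. *)
Lemma average_ge (lb : R) (k : 'I_n) : 0 < w k ->
  (forall j, 0 < w j -> lb <= x j) -> lb + rho * (x k - lb) <= \sum_j w j * x j.
Proof.
move=> wk lbx.
have -> : \sum_j w j * x j = lb + \sum_j w j * (x j - lb).
  under [in RHS]eq_bigr => j _ do rewrite mulrBr.
  by rewrite sumrB -mulr_suml w_sum mul1r addrC subrK.
rewrite lerD2l (bigD1 k) //= -[leLHS]addr0 lerD //.
  by rewrite ler_wpM2r ?subr_ge0 ?lbx // w_rho // gt_eqF.
apply: sumr_ge0 => j _; have [->|wj] := eqVneq (w j) 0; first by rewrite mul0r.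
by rewrite mulr_ge0 // subr_ge0 lbx // lt_neqAle eq_sym wj w_ge0.
Qed.
End Average.

Lemma average_le (R : realType) (n : nat) (rho : R) (w x : 'I_n -> R) (ub : R)
    (k : 'I_n) : (forall j, 0 <= w j) -> \sum_j w j = 1 ->
  (forall j, w j != 0 -> rho <= w j) -> 0 < w k ->
  (forall j, 0 < w j -> x j <= ub) -> \sum_j w j * x j <= ub - rho * (ub - x k).
Proof.
move=> w0 w1 wr wk xub.
have := @average_ge R n rho w (fun j => - x j) w0 w1 wr (- ub) k wk.
rewrite (eq_bigr (fun j => - (w j * x j))) => [|j _]; last by rewrite mulrN.
rewrite sumrN => /(_ _); move=> H.
have := H (fun j wj => ltac:(rewrite lerN2; exact: xub)).
lra.
Qed.

(** * Cuts and blocks of a configuration *)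

Section Configuration.
Variables (R : realType) (n : nat) (g : rel 'I_n) (x : 'I_n -> R) (sigma : nat -> 'I_n).
Hypotheses (g_sym : forall i j, g i j = g j i) (xsigma : sorts x sigma).

Let X (j : nat) : R := x (sigma j).

(** The outer boundaries 0 and [n] count as cuts by convention. An inner cut needs a positive gap,
    so agents at the same position are never separated. *)
Definition cut (l : nat) : bool :=
  [|| l == 0, (n <= l)%N | (x (sigma l.-1) < x (sigma l)) &&
    [forall i, forall j, g i j ==> ~~ ((x i <= x (sigma l.-1)) && (x (sigma l) <= x j))]].

Fixpoint block_left (j : nat) : R :=
  if j is j'.+1 then if cut j then x (sigma j) else block_left j' else x (sigma 0).

(** Recursion on the distance [k] to the last rank: a right end is inherited from the next rank
    unless a cut intervenes. *)
Fixpoint block_right_rev (k : nat) : R :=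
  if k is k'.+1 then
    if cut (n.-1 - k') then x (sigma (n.-1 - k)) else block_right_rev k'
  else x (sigma n.-1).

Definition block_right (j : nat) : R := block_right_rev (n.-1 - j).

Lemma X_mono (i j : nat) : (i <= j)%N -> (j < n)%N -> X i <= X j.
Proof. by case: xsigma => mono _ _; exact: mono. Qed.

Lemma sigma_onto (i : 'I_n) : exists2 k, (k < n)%N & sigma k = i.
Proof. by case: xsigma. Qed.

Lemma cut_up (l : nat) (i j : 'I_n) : cut l -> (l < n)%N -> g i j ->
  X l <= x i -> X l <= x j.
Proof.
move=> cl ln gij li; have [k kn kj] := sigma_onto j.
case: (leqP l k) => lk; first by rewrite -kj; exact: X_mono.
case/or3P: cl => [/eqP l0|nl|/andP[_ /forallP/(_ j)/forallP/(_ i)]]; [lia|lia|].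
rewrite g_sym gij /= -/(X l.-1) -/(X l) li andbT -ltNge -kj => lt.
by have := @X_mono k l.-1 ltac:(lia) ltac:(lia); rewrite leNgt lt.
Qed.

Lemma cut_down (h : nat) (i j : 'I_n) : cut h.+1 -> (h < n)%N -> g i j ->
  x i <= X h -> x j <= X h.
Proof.
move=> ch hn gij ih; have [k kn kj] := sigma_onto j.
case: (leqP k h) => hk; first by rewrite -kj; exact: X_mono.
case/or3P: ch => [//|nl|/andP[_ /forallP/(_ i)/forallP/(_ j)]]; first by lia.
rewrite gij /= -/(X h) -/(X h.+1) ih /= -ltNge -kj => lt.
by have := @X_mono h.+1 k hk kn; rewrite leNgt lt.
Qed.

Lemma uncut_edge (l : nat) : (l.+1 < n)%N -> ~~ cut l.+1 -> X l < X l.+1 ->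
  exists i j, [/\ g i j, x i <= X l & X l.+1 <= x j].
Proof.
move=> ln; rewrite /cut /= leqNgt ln /= -/(X l) -/(X l.+1) => /[swap] -> /=.
rewrite negb_forall => /existsP[i]; rewrite negb_forall => /existsP[j].
by rewrite negb_imply negbK => /and3P[gij il lj]; exists i, j.
Qed.

Lemma block_leftP (j : nat) : (j < n)%N -> exists l, [/\ (l <= j)%N, cut l,
  block_left j = X l & forall k, (l < k <= j)%N -> ~~ cut k].
Proof.
elim: j => [|j IH] jn; first by exists 0; split => // k; lia.
rewrite /=; case: ifP => cj; first by exists j.+1; split => // k; lia.
have [l [lj cl -> nc]] := IH (ltnW jn); exists l; split => //; first by lia.
move=> k /andP[lk]; rewrite leq_eqVlt => /orP[/eqP -> |kj]; first by rewrite cj.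
by apply: nc; rewrite lk.
Qed.

Lemma block_right_cut (j : nat) : (j < n)%N -> cut j.+1 -> block_right j = X j.
Proof.
move=> jn; rewrite /block_right; case E : (n.-1 - j)%N => [|k] /= cj.
  by congr (x (sigma _)); lia.
have -> : (n.-1 - k = j.+1)%N by lia.
by rewrite cj; congr (x (sigma _)); lia.
Qed.

Lemma block_right_uncut (j : nat) : (j.+1 < n)%N -> ~~ cut j.+1 ->
  block_right j.+1 = block_right j.
Proof.
move=> jn nc; rewrite /block_right (_ : (n.-1 - j = (n.-1 - j.+1).+1)%N) /=; last by lia.
by rewrite (_ : (n.-1 - (n.-1 - j.+1) = j.+1)%N) ?(negbTE nc) //; lia.
Qed.

Lemma block_rightP (j : nat) : (j < n)%N -> exists h, [/\ (j <= h < n)%N, cut h.+1,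
  block_right j = X h & forall k, (j < k <= h)%N -> ~~ cut k].
Proof.
move=> jn; have [d] : exists d, (n - j <= d)%N by exists (n - j)%N.
elim: d j jn => [|d IH] j jn; first by lia.
move=> njd; case cj : (cut j.+1).
  exists j; split => //; [by lia|exact: block_right_cut|by move=> k; lia].
have jn' : (j.+1 < n)%N.
  rewrite ltnNge; apply/negP => nj; move: cj.
  by rewrite /cut nj orbT.
have [h [hn ch e nc]] := IH j.+1 jn' ltac:(lia).
exists h; split => //; [by lia|by rewrite -e block_right_uncut ?cj|].
move=> k /andP[jk kh]; move: jk; rewrite leq_eqVlt => /orP[/eqP <-|jk]; first by rewrite cj.
by apply: nc; lia.
Qed.

(** Send a cut to the component of the agent on its right. The agents to the right of a cut are
    closed under edges, so distinct cuts go to distinct components. *)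
Lemma cuts_le_components : (\sum_(0 <= j < n) cut j <= num_components g)%N.
Proof.
have gs : connect_sym g by apply: sym_connect_sym => i j; rewrite g_sym.
have csym : connect_sym (connect g) by apply: sym_connect_sym => i j; rewrite gs.
rewrite big_mkord /num_components /n_comp_mem.
pose f (l : 'I_n) := fingraph.root (connect g) (sigma l).
pose A := [pred l : 'I_n | cut l].
have -> : (\sum_(l < n) cut l = #|A|)%N.
  by rewrite -sum1_card [RHS]big_mkcond; apply: eq_bigr => l _; rewrite inE; case: (cut l).
have sep (l l' : 'I_n) : cut l' -> (l < l')%N -> f l <> f l'.
  move=> cl' ll' /eqP; rewrite root_connect // => con.
  have cl : fingraph.closed g [pred i | X l' <= x i].
    by apply: intro_closed => // i j gij; rewrite !inE; exact: cut_up.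
  (* [num_components] takes [connect g] as its edge relation, hence two levels of
     [closed_connect]. *)
  have := closed_connect (fun i j => closed_connect cl (x := i) (y := j)) con.
  rewrite !inE lexx => Xl.
  case/or3P: cl' => [/eqP l0|nl|/andP[lt _]]; [by lia|by have := ltn_ord l'; lia|].
  have := @X_mono l l'.-1 ltac:(lia) ltac:(have := ltn_ord l'; lia).
  by rewrite leNgt (lt_le_trans lt).
have injf : {in A &, injective f}.
  move=> l l'; rewrite !inE => cl cl' ff; apply: val_inj => /=; apply/eqP.
  by case: ltngtP => // ll; [case: (sep _ _ cl' ll)|case: (sep _ _ cl ll)].
rewrite -(card_in_imset injf); apply: subset_leq_card; apply/fintype.subsetP => i.
by move=> /imsetP[l _ ->]; rewrite !inE andbT roots_root.
Qed.

(** The new position of rank [j] is bounded below by exhibiting [n - j] distinct agents that move to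
    at least the bound, and above by exhibiting [j + 1] agents that move to at most the bound. *)
Lemma twist_step_sorted (rho : R) (w : 'M[R]_n) (y : 'I_n -> R) (tau : nat -> 'I_n) :
  (0 < n)%N -> 0 <= rho -> (forall i, g i i) ->
  (forall i j, 0 <= w i j) -> (forall i, \sum_j w i j = 1) ->
  (forall i j, 0 < w i j <-> g i j) -> (forall i j, w i j != 0 -> rho <= w i j) ->
  (forall i, y i = \sum_j w i j * x j) -> sorts y tau ->
  twist_step rho n cut block_left block_right X (fun j => y (tau j)).
Proof.
move=> n0 rho0 g_refl w0 w1 wg wr yE ytau.
have cut_n : cut n by rewrite /cut leqnn orbT.
have [_ inj _] := xsigma.
have inj_lt k l : (k < l)%N -> (l < n)%N -> sigma k <> sigma l.
  by move=> kl ln /inj e; have := e ltac:(lia) ln; lia.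
have ge l i k : cut l -> (l < n)%N -> X l <= x i -> g i k ->
    X l + rho * (x k - X l) <= y i.
  move=> cl ln li gik; rewrite yE; apply: (average_ge (w0 i) (w1 i) (wr i)); first exact/wg.
  by move=> j /wg gij; exact: cut_up li.
have le h i k : cut h.+1 -> (h < n)%N -> x i <= X h -> g i k ->
    y i <= X h - rho * (X h - x k).
  move=> ch hn ih gik; rewrite yE; apply: (average_le (w0 i) (w1 i) (wr i)); first exact/wg.
  by move=> j /wg gij; exact: cut_down ih.
split.
- by [].
- exact: cut_n.
- by move=> j jn; exact: X_mono.
- by move=> j jn; have [l [lj _ -> _]] := block_leftP jn; exact: X_mono.
- by move=> j jn; have [h [/andP[jh hn] _ -> _]] := block_rightP jn; exact: X_mono.
- by move=> [|j] jn //= ->.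
- exact: block_right_cut.
- by move=> j jn /negbTE /= ->.
- exact: block_right_uncut.
- move=> j jn; have [l [lj cl -> _]] := block_leftP jn.
  have ln : (l < n)%N by lia.
  have bound (k : nat) (b : R) : (j <= k < n)%N -> b <= X k ->
      X l + rho * (b - X l) <= y (sigma k).
    move=> jk bk; apply: le_trans (ge l (sigma k) (sigma k) cl ln _ (g_refl _)).
      by rewrite lerD2l ler_wpM2l // lerD2r.
    by apply: X_mono; lia.
  case: ifP => cj.
    apply: (order_stat_ge ytau (h := sigma)) => // k jk; first by move=> *; exact: inj_lt.
    by apply: bound => //; apply: X_mono; lia.
  have jn' : (j.+1 < n)%N.
    by rewrite ltn_neqAle jn andbT; apply/eqP => e; move: cj; rewrite e cut_n.
  have [ltX|geX] := ltP (X j) (X j.+1).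
    (* Agents of rank above [j] reach the bound through their self-loops. The missing agent is [i],
       left of the gap and so distinct from them, which is pulled by its edge to [i'] across the
       gap. *)
    have [i [i' [gii ij ij']]] := uncut_edge jn' (negbT cj) ltX.
    apply: (order_stat_ge ytau (h := fun k => if k == j then i else sigma k)) => //.
      move=> k k' jk kk kn; have -> : (k' == j) = false by apply/eqP; lia.
      case: eqP => [_ e|_]; last exact: inj_lt.
      have := @X_mono j.+1 k' ltac:(lia) kn.
      by rewrite /X -e leNgt (le_lt_trans ij ltX).
    move=> k jk; case: eqP => [_|kj]; last first.
      by apply: bound => //; apply: X_mono; lia.
    apply: le_trans (ge l i i' cl ln _ gii).
      by rewrite lerD2l ler_wpM2l // lerD2r.
    apply: (cut_up cl ln (i := i')); first by rewrite g_sym.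
    by apply: le_trans ij'; apply: X_mono; lia.
  apply: (order_stat_ge ytau (h := sigma)) => // k jk; first by move=> *; exact: inj_lt.
  by apply: bound => //; apply: le_trans geX _; apply: X_mono; lia.
- move=> j jn; have [h [/andP[jh hn] ch -> _]] := block_rightP jn.
  have bound (k : nat) (b : R) : (k <= j)%N -> X k <= b ->
      y (sigma k) <= X h - rho * (X h - b).
    move=> kj kb; apply: le_trans (le h (sigma k) (sigma k) ch hn _ (g_refl _)) _.
      by apply: X_mono; lia.
    by rewrite lerD2l lerN2 ler_wpM2l // lerD2l lerN2.
  case: ifP => cj.
    apply: (order_stat_le ytau (h := sigma)) => // k; first by move=> *; apply: inj_lt; lia.
    by move=> kj; apply: bound => //; exact: X_mono.
  case: j jn jh bound cj => [//|j] jn jh bound cj /=.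
  have [ltX|geX] := ltP (X j) (X j.+1).
    have [i [i' [gii ij ij']]] := uncut_edge jn (negbT cj) ltX.
    apply: (order_stat_le ytau (h := fun k => if k == j.+1 then i' else sigma k)) => //.
      move=> k k' kk kj; have -> : (k == j.+1) = false by apply/eqP; lia.
      case: eqP => [_ e|_]; last by apply: inj_lt; lia.
      have := @X_mono k j ltac:(lia) ltac:(lia).
      by rewrite /X e leNgt (lt_le_trans ltX ij').
    move=> k kj; case: eqP => [_|kj']; last first.
      by apply: bound => //; apply: X_mono; lia.
    apply: le_trans (le h i' i ch hn _ _) _; last first.
    + by rewrite lerD2l lerN2 ler_wpM2l // lerD2l lerN2.
    + by rewrite g_sym.
    apply: (cut_down ch hn (i := i)) => //.
    by apply: le_trans ij _; apply: X_mono; lia.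
  apply: (order_stat_le ytau (h := sigma)) => // k; first by move=> *; apply: inj_lt; lia.
  by move=> kj; apply: bound => //; apply: le_trans geX; apply: X_mono.
Qed.

(** * Blocks as intervals of the line *)

Lemma edge_union_edge (z : R) (i j : 'I_n) : x i < x j -> g i j ->
  x i <= z <= x j -> edge_union g x z.
Proof.
move=> ij gij zij; exists i, j; split => //.
  by apply: contraTneq ij => ->; rewrite ltxx.
by rewrite min_l ?max_r // ltW.
Qed.

Lemma edge_union_bounds (z : R) : edge_union g x z ->
  exists i j, [/\ g i j, x i <= z <= x j & i != j].
Proof.
case=> i [j [ij gij]]; have [lt|lt] := leP (x i) (x j) => zij.
  by exists i, j.
by exists j, i; rewrite g_sym eq_sym.
Qed.

Lemma edge_union_gap (l : nat) (z : R) : cut l -> (0 < l < n)%N ->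
  edge_union g x z -> X l.-1 < z -> X l <= z.
Proof.
move=> cl /andP[l0 ln] /edge_union_bounds[i [j [gij /andP[iz zj] _]]] lz.
apply: le_trans iz; apply: (cut_up cl ln (i := j)); first by rewrite g_sym.
have [k kn kj] := sigma_onto j; rewrite -kj; apply: X_mono => //.
rewrite leqNgt; apply/negP => kl; have := @X_mono k l.-1 ltac:(lia) ltac:(lia).
by rewrite /X kj leNgt (lt_le_trans lz).
Qed.

(** Within a run without inner cut, each gap of positive length is crossed by an edge. [X l < X h]
    rules out a lone agent, whose position need not lie in the union. *)
Lemma edge_union_block (l h : nat) (z : R) : (l <= h)%N -> (h < n)%N ->
  (forall k, (l < k <= h)%N -> ~~ cut k) -> X l < X h -> X l <= z <= X h ->
  edge_union g x z.
Proof.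
elim: h => [|h IH] lh hn nc ltX /andP[lz zh].
  by move: lh ltX; rewrite leqn0 => /eqP ->; rewrite ltxx.
have {}lh : (l <= h)%N.
  by move: lh; rewrite leq_eqVlt => /orP[/eqP e|//]; move: ltX; rewrite e ltxx.
have last : X h < X h.+1 -> X h <= z -> edge_union g x z.
  move=> ltXh hz; have [i [j [gij ih hj]]] := uncut_edge hn (nc h.+1 ltac:(lia)) ltXh.
  apply: (edge_union_edge _ gij); first exact: le_lt_trans (lt_le_trans ltXh hj).
  by rewrite (le_trans ih hz) (le_trans zh hj).
have [hz|zh'] := ltP (X h) z.
  by apply: last; [exact: lt_le_trans zh|exact: ltW].
have [ltX'|geX] := ltP (X l) (X h).
  by apply: IH; rewrite ?lz //; [lia|move=> k kh; apply: nc; lia].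
by apply: last; [exact: le_lt_trans ltX|exact: le_trans lz].
Qed.

(** A component is an interval inside the union, so it cannot enter a cut gap; conversely the
    segment spanned by the run is connected and lies in the union. *)
Lemma blocks_itv (B : set R) : blocks g x B ->
  exists2 l, (l < n)%N & cut l /\ B = `[X l, block_right l]%classic.
Proof.
case=> z Uz <-; have [i [j [gij /andP[iz zj] _]]] := edge_union_bounds Uz.
have [k kn ki] := sigma_onto i.
have [l [lk cl _ ncl]] := block_leftP kn.
have ln : (l < n)%N by lia.
have [h [/andP[lh hn] ch hE nch]] := block_rightP ln.
have kh : (k <= h)%N.
  by rewrite leqNgt; apply/negP => hk; move: (ncl h.+1 ltac:(lia)); rewrite ch.
have li : X l <= x i by rewrite -ki; apply: X_mono; lia.
have ih : x i <= X h by rewrite -ki; apply: X_mono; lia.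
have zlh : X l <= z <= X h.
  by rewrite (le_trans li iz) (le_trans zj (cut_down ch hn gij ih)).
have [lz zh] := andP zlh.
exists l => //; split => //; rewrite hE; apply/seteqP; split => t /=.
  move=> Ct.
  have Cz : connected_component (edge_union g x) z z by exact: connected_component_refl.
  have CU := @connected_component_sub R (edge_union g x) z.
  have Ci : is_interval (connected_component (edge_union g x) z).
    by apply/connected_intervalP; exact: component_connected.
  rewrite /= in_itv /=; apply/andP; split; rewrite leNgt; apply/negP => lt.
    case: (posnP l) => [l0|l0].
      have [i' [j' [_ /andP[it _] _]]] := edge_union_bounds (CU _ Ct).
      have [k' kn' ki'] := sigma_onto i'.
      have := @X_mono l k' ltac:(lia) kn'.
      by rewrite leNgt /X ki' (le_lt_trans it).
    have ltl : X l.-1 < X l.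
      by move: cl; rewrite /cut eqn0Ngt l0 leqNgt ln /= => /andP[].
    (* [w] lies strictly inside the cut gap, where the union has no point. *)
    pose w := (Num.max t (X l.-1) + X l) / 2.
    have mx : Num.max t (X l.-1) < X l by rewrite gt_max lt.
    have tm : t <= Num.max t (X l.-1) by rewrite le_max lexx.
    have pm : X l.-1 <= Num.max t (X l.-1) by rewrite le_max lexx orbT.
    have Cw : connected_component (edge_union g x) z w.
      by apply: (Ci t z) => //; apply/andP; split; rewrite /w; lra.
    have := edge_union_gap cl _ (CU _ Cw); rewrite l0 ln => /(_ isT).
    by rewrite /w => H; have := H ltac:(lra); lra.
  case: (ltnP h.+1 n) => [hn'|nh]; last first.
    have [i' [j' [_ /andP[_ tj] _]]] := edge_union_bounds (CU _ Ct).
    have [k' kn' kj'] := sigma_onto j'.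
    have := @X_mono k' h ltac:(lia) hn.
    by rewrite leNgt /X kj' (lt_le_trans lt).
  have lth : X h < X h.+1.
    by move: ch; rewrite /cut /= leqNgt hn' /= => /andP[].
  pose w := (Num.min t (X h.+1) + X h) / 2.
  have mx : X h < Num.min t (X h.+1) by rewrite lt_min lt.
  have tm : Num.min t (X h.+1) <= t by rewrite ge_min lexx.
  have pm : Num.min t (X h.+1) <= X h.+1 by rewrite ge_min lexx orbT.
  have Cw : connected_component (edge_union g x) z w.
    by apply: (Ci z t) => //; apply/andP; split; rewrite /w; lra.
  have := edge_union_gap ch _ (CU _ Cw); rewrite hn' => /(_ isT).
  by rewrite /w /= => H; have := H ltac:(lra); lra.
move: t; apply: connected_component_max.
- by rewrite /= in_itv.
- move=> t /=; rewrite in_itv /= => tlh.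
  have [lt|ge] := ltP (X l) (X h); first exact: edge_union_block tlh.
  (* A run of length 0 is the single point [z], which is in the union by choice. *)
  suff -> : t = z by [].
  by have /andP[] := tlh; lra.
- exact: segment_connected.
Qed.

(** Only an inequality, since a run made of a lone agent need not give a block. *)
Lemma energy_step_le (s : R) :
  energy_step s g x <= block_energy s cut block_right X 0 n.
Proof.
pose f l := `[X l, block_right l]%classic : set R.
pose F (B : set R) : R := block_length B `^ s.
have F0 B : 0 <= F B by exact: powR_ge0.
apply: le_trans (fsum_le_seq (r := [seq f l | l <- index_iota 0 n & cut l]) F0 _) _.
  move=> B /blocks_itv[l ln [cl ->]]; rewrite /=.
  by apply: map_f; rewrite mem_filter cl mem_index_iota.
rewrite big_map big_filter /block_energy big_nat_cond [leRHS]big_nat_cond.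
apply: ler_sum => l /andP[/andP[_ ln] _].
have lr : X l <= block_right l.
  by have [h [/andP[lh hn] _ -> _]] := block_rightP ln; exact: X_mono.
by rewrite /F /f /block_length sup_itvcc // inf_itvcc.
Qed.
End Configuration.

(** * Energy of an averaging system *)

Lemma s_energy_le (R : realType) (n : nat) (s B : R) (G : nat -> rel 'I_n)
    (P : nat -> 'M[R]_n) (x0 : 'I_n -> R) :
  (forall T, \sum_(0 <= t < T) energy_step s (G t) (traj P x0 t) <= B) ->
  (s_energy s G P x0 <= B%:E)%E.
Proof.
move=> EB; apply: lime_le.
  apply: is_cvg_nneseries => t _ _; rewrite lee_fin.
  by apply: fsumr_ge0 => C _; exact: powR_ge0.
by apply: nearW => T; rewrite sumEFin lee_fin.
Qed.

Lemma averaging_energy_le (R : realType) (n m : nat) (rho s : R)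
    (G : nat -> rel 'I_n) (P : nat -> 'M[R]_n) (x0 : 'I_n -> R) :
  (1 < n)%N -> 0 < rho -> rho <= 2^-1 -> 0 < s -> s <= 1 ->
  averaging_system rho G P -> (forall t, (num_components (G t) <= m)%N) ->
  (forall i, 0 <= x0 i <= 1) ->
  (s_energy 1 G P x0 <= (4 * rho^-1 ^+ n./2)%:E)%E /\
  (s_energy s G P x0 <= ((52 * m%:R * n%:R / s) ^+ m * rho^-1 ^+ n.-1)%:E)%E.
Proof.
move=> n1 rho0 rho2 s0 s1 sys comp x01; have n0 : (0 < n)%N by exact: ltnW.
(* The agents are sorted anew at every time, so that ranks, and not agents, follow the twist
   dynamics. *)
have [sg sgP] := choice (fun t => sorts_exists (traj P x0 t) n0).
pose X t j := traj P x0 t (sg t j).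
pose c t := cut (G t) (traj P x0 t) (sg t).
pose p t := block_left (G t) (traj P x0 t) (sg t).
pose q t := block_right (G t) (traj P x0 t) (sg t).
have tw t : twist_step rho n (c t) (p t) (q t) (X t) (X t.+1).
  have [[gs gr] w0 w1 wg wr] := sys t.
  by apply: (twist_step_sorted gs (sgP t) n0 (ltW rho0) gr w0 w1 wg wr _ (sgP t.+1)).
have step u t : energy_step u (G t) (traj P x0 t) <= block_energy u (c t) (q t) (X t) 0 n.
  by have [[gs _] _ _ _ _] := sys t; exact: (energy_step_le gs (sgP t)).
have cm t : (\sum_(0 <= j < n) c t j <= m)%N.
  have [[gs _] _ _ _ _] := sys t.
  exact: leq_trans (cuts_le_components gs (sgP t)) (comp t).
have D0 : 0 <= diam X 0 0 n.-1 by apply: (diam_ge0 tw); lia.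
have D1 : diam X 0 0 n.-1 <= 1.
  rewrite /diam /X /=; have /andP[_ up] := x01 (sg 0 (0 + n.-1)%N).
  by have /andP[lo _] := x01 (sg 0 0%N); lra.
have r0 k : 0 <= rho^-1 ^+ k by rewrite exprn_ge0 // invr_ge0 ltW.
split; apply: s_energy_le => T; apply: (le_trans (ler_sum _ (fun t _ => step _ t))).
  apply: le_trans (energy1_bound rho0 rho2 tw T n1) _.
  by rewrite ler_piMr // mulr_ge0.
apply: le_trans (total_energy_bound rho0 rho2 tw s0 T s1 n1 cm) _.
rewrite ler_piMr ?mulr_ge0 ?exprn_ge0 ?mulr_ge0 ?invr_ge0 ?(ltW s0) ?(ltW rho0) //.
have <- : 1 `^ s = 1 :> R by rewrite powR1.
by rewrite ge0_ler_powR ?nnegrE ?(ltW s0).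
Qed.

Theorem theorem1 :
  exists C : Rdefinitions.R, 0 < C /\
  forall (n : nat) (rho : Rdefinitions.R) (m : nat) (s : Rdefinitions.R),
    (2 <= n)%N -> 0 < rho -> rho <= 2^-1 ->
    (1 <= m)%N -> (m <= n.-1)%N -> 0 < s -> s <= 1 ->
    (sup_energy n rho m 1 <=
       (3 * expR 1 * n%:R * (rho^-1) ^+ n./2)%:E)%E /\
    (sup_energy n rho m s <=
       (((C * m%:R * n%:R) / s) ^+ m * (rho^-1) ^+ n.-1)%:E)%E.
Proof.
exists 52; split => // n rho m s n2 rho0 rho2 _ _ s0 s1.
(* Since [expR 1] and [n] are at least 2, the right side is at least 12. *)
have constant_le : 4 <= 3 * expR 1 * n%:R :> Rdefinitions.R.
  have e1 : 2 <= expR 1 :> Rdefinitions.R by have := @expR_ge1Dx Rdefinitions.R 1; lra.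
  have n2R : 2 <= n%:R :> Rdefinitions.R by rewrite (ler_nat _ 2).
  by nra.
split; apply: ge_ereal_sup => _ [G [P [x0 [sys comp x01 ->]]]];
  have [E1 Es] := averaging_energy_le n2 rho0 rho2 s0 s1 sys comp x01 => //.
apply: le_trans E1 _; rewrite lee_fin ler_wpM2r //.
by rewrite exprn_ge0 // invr_ge0 ltW.
Qed.
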